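(* Let $n\ge 1$ and $m\ge 2$, and let $\lambda=(n,\dots,n)$ be the $m$-row rectangular shape ($m$ rows of length $n$). Let $M_\lambda=nT_{m-1}=n\binom{m}{2}$ be the maximum inversion number for shape $\lambda$. Then $|S_{M_\lambda-1}(\lambda)|=mn-1$.
   Context: A tableau of shape $\lambda$ is a bijective filling of the $m\times n$ array with $1,\dots,mn$; it is row-standard if entries increase left to right along each row. For a row-standard tableau $\tau$, a pair of entries $i<j$ in the same column is an inversion if either (1) $i$ or $j$ has no entry immediately to its right and $i$ lies below $j$, or (2) $i$ is immediately followed on its right by $i'$, $j$ is immediately followed on its right by $j'$, and $i'>j'$. $S_i(\lambda)$ is the set of row-standard tableaux of shape $\lambda$ with exactly $i$ inversions. $T_k=k(k+1)/2$ denotes the $k$-th triangular number. *)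

(* Defs.v *)
From mathcomp Require Import all_boot.

Set Implicit Arguments.
Unset Strict Implicit.
Unset Printing Implicit Defensive.

(* The cell (r, c) lies in row r and column c, both counted from 0; rows are
   numbered from top to bottom and columns from left to right. The value k of
   a filling stands for the entry k + 1 of {1, ..., mn}. *)
Definition cell (m n : nat) : finType := ('I_m * 'I_n)%type.

Definition filling (m n : nat) : finType := {ffun cell m n -> 'I_(m * n)}.

Definition entry (m n : nat) (t : filling m n) (x : cell m n) : nat :=
  (t x).+1.

Definition is_tableau (m n : nat) (t : filling m n) : bool :=
  injectiveb t && [forall k : 'I_(m * n), exists x : cell m n, t x == k].

Definition row_standard (m n : nat) (t : filling m n) : bool :=
  [forall r : 'I_m, forall c1 : 'I_n, forall c2 : 'I_n,
     (c1 < c2) ==> (entry t (r, c1) < entry t (r, c2))].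

Definition row_standard_tableaux (m n : nat) : {set filling m n} :=
  [set t | is_tableau t && row_standard t].

(* None when the cell is in the last column *)
Definition right_entry (m n : nat) (t : filling m n) (x : cell m n)
    : option nat :=
  omap (fun c : 'I_n => entry t (x.1, c)) (insub x.2.+1).

(* x is the cell of the smaller entry i, y that of the larger entry j *)
Definition is_inversion (m n : nat) (t : filling m n) (x y : cell m n) : bool :=
  [&& x.2 == y.2, entry t x < entry t y &
    match right_entry t x, right_entry t y with
    | Some i', Some j' => j' < i'
    | _, _ => y.1 < x.1
    end].

Definition inversions (m n : nat) (t : filling m n) : nat :=
  #|[set p : cell m n * cell m n | is_inversion t p.1 p.2]|.

Definition S_ (i m n : nat) : {set filling m n} :=
  [set t in row_standard_tableaux m n | inversions t == i].

Definition max_inversions (m n : nat) : nat :=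
  \max_(t in row_standard_tableaux m n) inversions t.

Definition triangular (k : nat) : nat := (k * k.+1) %/ 2.

(* Main.v *)
Require Import Defs.
From mathcomp Require Import all_boot.
From mathcomp Require Import zify.

(* Each column of a tableau orders the rows. Put to the right of the last column
   a virtual one which orders the rows by index: then a pair of rows is an
   inversion in column c exactly when columns c and c + 1 order it differently.
   So there are at most n * 'C(m, 2) inversions, and a tableau has one less when
   a single pair of rows r < s keeps its order from column c0 to c0 + 1. By
   transitivity in column c0 this forces s = r + 1, and (c0, r) determines the
   order within each column. Comparing adjacent columns through a common row
   shows that all entries of a column are smaller than those of the next one,
   with one possible exception: if c0 is not the last column and r, r + 1 are
   the rows of its two largest entries, then the largest entry of column c0 and
   the smallest one of column c0 + 1 may come in either order. This gives
   n * (m - 1) + (n - 1) = m * n - 1 tableaux. *)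

Set Implicit Arguments.
Unset Strict Implicit.
Unset Printing Implicit Defensive.

(** * Row orders of the columns, and values filling consecutive blocks *)

Definition swapS (k i : nat) : nat :=
  if i == k then k.+1 else if i == k.+1 then k else i.

Lemma swapS_lt (k i N : nat) : k.+1 < N -> i < N -> swapS k i < N.
Proof. by rewrite /swapS; repeat case: eqP => ?; lia. Qed.

Lemma swapS_inj (k : nat) : injective (swapS k).
Proof. by move=> i j; rewrite /swapS; repeat case: eqP => ?; lia. Qed.

Lemma swapS_ltn (k i j : nat) :
  (swapS k i < swapS k j) =
  (i == k.+1) && (j == k) || (i < j) && ~~ ((i == k) && (j == k.+1)).
Proof. by rewrite /swapS; repeat case: eqP => ? /=; lia. Qed.

(** Counting back from the virtual column [n], each step reverses the order, hence the parity of
    [n - c]. The pair [r0], [r0.+1] misses one reversal, between columns [k.-1] and [k], which shows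
    as a swap in all columns before [k]; [k = 0] means no defect. *)
Definition row_rank (m n k r0 c r : nat) : nat :=
  let r' := if c < k then swapS r0 r else r in
  if odd (n - c) then m.-1 - r' else r'.

Definition block_value (m n k r0 r c : nat) : nat :=
  c * m + row_rank m n k r0 c r.

Lemma row_rank_lt (m n k r0 c r : nat) :
  r0.+1 < m -> r < m -> row_rank m n k r0 c r < m.
Proof.
move=> hr0 hr; rewrite /row_rank.
have := swapS_lt hr0 hr; case: (c < k); case: odd; lia.
Qed.

Lemma row_rank_inj (m n k r0 c r s : nat) : r0.+1 < m -> r < m -> s < m ->
  row_rank m n k r0 c r = row_rank m n k r0 c s -> r = s.
Proof.
move=> hr0 hr hs; rewrite /row_rank.
have := swapS_lt hr0 hr; have := swapS_lt hr0 hs; have := @swapS_inj r0 r s.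
case: (c < k); case: odd => h ? ? e; [apply: h | apply: h | |]; lia.
Qed.

Lemma odd_subS (n c : nat) : c < n -> odd (n - c) = ~~ odd (n - c.+1).
Proof. by move=> h; rewrite -[n - c]prednK ?subn_gt0 // -subnS. Qed.

Lemma row_rank_next (m n k r0 c r : nat) :
  c < n -> c.+1 != k -> r0.+1 < m -> r < m ->
  row_rank m n k r0 c r + row_rank m n k r0 c.+1 r = m.-1.
Proof.
move=> hc hk hr0 hr; rewrite /row_rank odd_subS //.
have -> : (c.+1 < k) = (c < k) by lia.
by have := swapS_lt hr0 hr; case: (c < k); case: odd => /=; lia.
Qed.

Lemma block_value_ltn (m n k r0 r c s d : nat) :
  r0.+1 < m -> r < m -> s < m ->
  (block_value m n k r0 r c < block_value m n k r0 s d) =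
  (c < d) || (c == d) && (row_rank m n k r0 c r < row_rank m n k r0 d s).
Proof.
move=> hr0 hr hs; rewrite /block_value.
have := row_rank_lt n k c hr0 hr; have := row_rank_lt n k d hr0 hs.
move: (row_rank m n k r0 c r) (row_rank m n k r0 d s) => a b hb ha.
case: (ltngtP c d) => [h|h|->] /=; last by rewrite ltn_add2l.
- have : c.+1 * m <= d * m by rewrite leq_mul2r h orbT.
  by rewrite mulSn; lia.
- have : d.+1 * m <= c * m by rewrite leq_mul2r h orbT.
  by rewrite mulSn; lia.
Qed.

Lemma block_value_inj (m n k r0 r c s d : nat) :
  r0.+1 < m -> r < m -> s < m ->
  block_value m n k r0 r c = block_value m n k r0 s d -> r = s /\ c = d.
Proof.
move=> hr0 hr hs e.
have := block_value_ltn n k c d hr0 hr hs.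
have := block_value_ltn n k d c hr0 hs hr.
rewrite e ltnn; case: (ltngtP c d) => //= -> h1 h2; split=> //.
by apply: (@row_rank_inj m n k r0 d) => //; lia.
Qed.

Lemma block_value_lt (m n k r0 r c : nat) :
  r0.+1 < m -> r < m -> c < n -> block_value m n k r0 r c < m * n.
Proof.
move=> hr0 hr hc; rewrite /block_value.
have := row_rank_lt n k c hr0 hr.
have : c.+1 * m <= n * m by rewrite leq_mul2r hc orbT.
by rewrite mulSn; lia.
Qed.

(** Swapping two adjacent rows changes the comparison of that one pair only. *)
Lemma row_rank_ltn (m n k r0 c u v : nat) : r0.+1 < m -> u < v -> v < m ->
  (row_rank m n k r0 c u < row_rank m n k r0 c v) =
  ~~ odd (n - c) (+) [&& c < k, u == r0 & v == r0.+1].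
Proof.
move=> hr0 huv hv; rewrite /row_rank /swapS.
by case: odd; case: (c < k) => /=; repeat case: eqP => ? /=; lia.
Qed.

Lemma row_rank_stable (m n k r0 c u v : nat) :
  c < n -> r0.+1 < m -> u < v -> v < m ->
  ((row_rank m n k r0 c u < row_rank m n k r0 c v) ==
   (row_rank m n k r0 c.+1 u < row_rank m n k r0 c.+1 v)) =
  [&& c.+1 == k, u == r0 & v == r0.+1].
Proof.
move=> hc hr0 huv hv; rewrite !row_rank_ltn // odd_subS //.
by case: odd; case: (u == r0); case: (v == r0.+1) => /=; lia.
Qed.

(* The value of [r0] for which rows [r0] and [r0.+1] hold the two largest
   entries of column [k.-1] and the two smallest of column [k]. *)
Definition top_row (m n k : nat) : nat := if odd (n - k) then m.-2 else 0.

Lemma top_row_lt (m n k : nat) : 1 < m -> (top_row m n k).+1 < m.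
Proof. by rewrite /top_row; case: odd; lia. Qed.

(** The defect pair keeps its order, so the top row of column [k.-1] is only second smallest in
    column [k]. Hence the two border values never share a row. *)
Lemma row_rank_top (m n k r : nat) : 0 < k < n -> 1 < m -> r < m ->
  row_rank m n k (top_row m n k) k.-1 r = m.-1 ->
  row_rank m n k (top_row m n k) k r <> 0.
Proof.
move=> /andP[k0 kn] hm hr; rewrite /row_rank /top_row /swapS ltnn prednK //.
rewrite leqnn (@odd_subS n k.-1); last by lia.
by rewrite prednK //; case: odd => /=; repeat case: eqP => ? /=; lia.
Qed.

(** [u] or [v] serves as [w] unless [u] ranks above [v] in both columns. Then they form the defect
    pair, and any row above [u] in column [k.-1] lies below [v] in column [k]; none exists exactly
    when [u] is on top. *)
Lemma row_rank_bridge (m n k r0 u v : nat) :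
  0 < k < n -> r0.+1 < m -> u < m -> v < m ->
  (exists2 w, w < m &
     row_rank m n k r0 k.-1 u <= row_rank m n k r0 k.-1 w /\
     row_rank m n k r0 k w <= row_rank m n k r0 k v) \/
  [/\ r0 = top_row m n k, row_rank m n k r0 k.-1 u = m.-1 &
      row_rank m n k r0 k v = 0].
Proof.
move=> /andP[k0 kn] hr0 hu hv.
pose P w := (row_rank m n k r0 k.-1 u <= row_rank m n k r0 k.-1 w) &&
            (row_rank m n k r0 k w <= row_rank m n k r0 k v).
have Pex w : w < m -> P w -> exists2 w, w < m &
     row_rank m n k r0 k.-1 u <= row_rank m n k r0 k.-1 w /\
     row_rank m n k r0 k w <= row_rank m n k r0 k v.
  by move=> hw /andP[]; exists w.
(* The top row of column [k.-1] is [0] or [m.-1], unless it belongs to the defect pair. *)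
have : [|| P u, P v, P 0, P m.-1 |
  [&& r0 == top_row m n k, row_rank m n k r0 k.-1 u == m.-1 &
      row_rank m n k r0 k v == 0]].
  rewrite /P /row_rank /top_row ltnn prednK // (leqnn k).
  rewrite (@odd_subS n k.-1); last by lia.
  rewrite prednK // /swapS.
  by case: odd => /=; repeat case: eqP => ? /=; lia.
case/or4P => [/Pex|/Pex|/Pex|/orP[/Pex|/and3P[/eqP ? /eqP ? /eqP ?]]];
  try (by move=> h; left; apply: h; lia).
by right.
Qed.

Lemma euclid_uniq (m c p d q : nat) :
  p < m -> q < m -> c * m + p = d * m + q -> c = d /\ p = q.
Proof.
move=> hp hq e; have m0 : 0 < m by lia.
have ecd : c = d.
  by have := congr1 (divn^~ m) e; rewrite /= !divnMDl // !divn_small // !addn0.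
by split=> //; move: e; rewrite ecd => /addnI.
Qed.

Lemma block_value_max (m n k r0 r c : nat) :
  0 < k -> r0.+1 < m -> r < m -> block_value m n k r0 r c = (k * m).-1 ->
  c = k.-1 /\ row_rank m n k r0 c r = m.-1.
Proof.
move=> k0 hr0 hr e.
apply: (@euclid_uniq m); rewrite ?row_rank_lt //; first by lia.
by rewrite [LHS]e -{1}(prednK k0) mulSn; lia.
Qed.

Lemma block_value_min (m n k r0 r c : nat) :
  r0.+1 < m -> r < m -> block_value m n k r0 r c = k * m ->
  c = k /\ row_rank m n k r0 c r = 0.
Proof.
move=> hr0 hr e; apply: (@euclid_uniq m); rewrite ?row_rank_lt //; first by lia.
by rewrite [LHS]e addn0.
Qed.

Lemma block_value_cell_inj (m n k r0 : nat) : r0.+1 < m ->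
  injective (fun x : cell m n => block_value m n k r0 x.1 x.2).
Proof.
move=> hr0 [u c] [v d] /= e.
by have [/val_inj-> /val_inj->] :=
  block_value_inj hr0 (ltn_ord u) (ltn_ord v) e.
Qed.

(** * Fillings and tableaux *)

Lemma cell_gt0 (m n : nat) (x : cell m n) : 0 < m * n.
Proof. by case: x => [[u hu] [c hc]]; rewrite muln_gt0; lia. Qed.

(** The default of [insubd] is [0], available since [x] is a cell; it does not interfere as long as
    [f] stays below [m * n]. *)
Definition filling_of (m n : nat) (f : nat -> nat -> nat) : filling m n :=
  [ffun x : cell m n => insubd (Ordinal (cell_gt0 x)) (f x.1 x.2)].

Lemma filling_ofE (m n : nat) (f : nat -> nat -> nat) (x : cell m n) :
  f x.1 x.2 < m * n -> filling_of m n f x = f x.1 x.2 :> nat.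
Proof. by move=> h; rewrite ffunE val_insubd h. Qed.

Lemma is_tableauP (m n : nat) (t : filling m n) :
  reflect (injective t) (is_tableau t).
Proof.
apply: (iffP andP) => [[/injectiveP //]|inj]; split; first exact/injectiveP.
apply/forallP => k; apply/existsP.
have cardE : #|cell m n| >= #|'I_(m * n)| by rewrite card_prod !card_ord.
have /mapP[x _ ->] := inj_card_onto inj cardE k.
by exists x.
Qed.

Lemma row_standardP (m n : nat) (t : filling m n) :
  reflect (forall (r : 'I_m) (c1 c2 : 'I_n), c1 < c2 -> t (r, c1) < t (r, c2))
    (row_standard t).
Proof.
apply: (iffP forallP) => [h r c1 c2 lt|h r].
  by have /forallP/(_ c1)/forallP/(_ c2)/implyP/(_ lt) := h r.
by apply/forallP => c1; apply/forallP => c2; apply/implyP => /(h r).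
Qed.

Lemma card_ord_lt (N j : nat) : j <= N -> #|[set k : 'I_N | k < j]| = j.
Proof.
move=> hj; rewrite -sum1dep_card.
by rewrite -(big_ord_widen _ (fun _ => 1)) // sum_nat_const card_ord muln1.
Qed.

(* An entry of a bijective filling is the number of smaller entries. *)
Lemma tableau_eq (m n : nat) (t t' : filling m n) :
  injective t -> injective t' ->
  (forall x y, t' x < t' y -> t x < t y) -> t = t'.
Proof.
have rankE (s : filling m n) (x : cell m n) : injective s ->
    #|[set y | s y < s x]| = s x :> nat.
  move=> inj.
  have bij : bijective s.
    by apply: inj_card_bij => //; rewrite card_prod !card_ord.
  rewrite -(card_imset _ inj).
  have -> : s @: [set y | s y < s x] = [set k : 'I_(m * n) | k < s x].
    apply/setP => k; case: bij => g gK sK.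
    apply/imsetP/idP => [[y + ->]|]; rewrite !inE // => h.
    by exists (g k); rewrite ?inE sK.
  by rewrite card_ord_lt // ltnW.
move=> inj inj' h; apply/ffunP => x; apply/val_inj => /=.
rewrite -(rankE t) // -(rankE t') //; apply: eq_card => y; rewrite !inE.
apply/idP/idP => [lt|/h //].
case: (ltngtP (t' y) (t' x)) => [//|/h|/val_inj/inj' e]; first by lia.
by move: lt; rewrite e ltnn.
Qed.

(* Column n is virtual, with rows ordered by their index: with this convention
   inversions in the last column read like those in the others. *)
Definition row_lt (m n : nat) (t : filling m n) (u v : 'I_m) (c : nat) : bool :=
  if insub c is Some c' then t (u, c') < t (v, c') else u < v.

Lemma row_ltE (m n : nat) (t : filling m n) (u v : 'I_m) (c : 'I_n) :
  row_lt t u v c = (t (u, c) < t (v, c)).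
Proof. by rewrite /row_lt valK. Qed.

Lemma row_lt_last (m n : nat) (t : filling m n) (u v : 'I_m) :
  row_lt t u v n = (u < v).
Proof. by rewrite /row_lt insubF // ltnn. Qed.

Lemma row_lt_antisym (m n : nat) (t : filling m n) (u v : 'I_m) (c : nat) :
  injective t -> u != v -> row_lt t v u c = ~~ row_lt t u v c.
Proof.
move=> inj nuv; rewrite /row_lt; case: insubP => [c' _ _|_]; rewrite -leqNgt.
  rewrite [RHS]leq_eqVlt; case: eqP => // /val_inj/inj [] e.
  by rewrite e eqxx in nuv.
by rewrite [RHS]leq_eqVlt eq_sym (inj_eq val_inj) (negPf nuv).
Qed.

(** * Inversions and defects *)

Lemma is_inversionE (m n : nat) (t : filling m n) (u v : 'I_m) (c : 'I_n) :
  is_inversion t (u, c) (v, c) = row_lt t u v c && row_lt t v u c.+1.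
Proof.
rewrite /is_inversion /right_entry eqxx row_ltE /row_lt /entry /= ltnS.
by case: insubP.
Qed.

Definition row_pairs (m n : nat) : {set 'I_n * ('I_m * 'I_m)} :=
  [set x : 'I_n * ('I_m * 'I_m) | x.2.1 < x.2.2].

Definition defects (m n : nat) (t : filling m n) : {set 'I_n * ('I_m * 'I_m)} :=
  [set x : 'I_n * ('I_m * 'I_m) | (x.2.1 < x.2.2) &&
    (row_lt t x.2.1 x.2.2 x.1 == row_lt t x.2.1 x.2.2 x.1.+1)].

Lemma card_row_pairs (m n : nat) : #|row_pairs m n| = n * 'C(m, 2).
Proof.
have -> : row_pairs m n = setX [set: 'I_n] [set p : 'I_m * 'I_m | p.1 < p.2].
  by apply/setP => -[c [u v]]; rewrite !inE.
rewrite cardsX cardsT card_ord; congr (_ * _).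
rewrite -sum1dep_card -bin2_sum big_mkord.
rewrite -(pair_big_dep xpredT (fun u v : 'I_m => u < v) (fun _ _ => 1)) /=.
rewrite (exchange_big_dep xpredT) //=; apply: eq_bigr => v _.
by rewrite sum1dep_card card_ord_lt // ltnW.
Qed.

Lemma inversions_defects (m n : nat) (t : filling m n) : injective t ->
  inversions t + #|defects t| = n * 'C(m, 2).
Proof.
move=> inj; rewrite -card_row_pairs -(cardsID (defects t) (row_pairs m n)).
have -> : row_pairs m n :&: defects t = defects t.
  by apply/setIidPr/subsetP => x; rewrite !inE => /andP[].
rewrite addnC; congr (_ + _).
(* [f] puts the cell with the smaller entry first, as [is_inversion] requires. *)
pose f (x : 'I_n * ('I_m * 'I_m)) : cell m n * cell m n :=
  let: (c, (u, v)) := x in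
  if row_lt t u v c then ((u, c), (v, c)) else ((v, c), (u, c)).
have f_inj : {in row_pairs m n :\: defects t &, injective f}.
  move=> [c [u v]] [d [u' v']]; rewrite !inE /f /= => /andP[_ h] /andP[_ h'].
  by do 2 case: ifP => _; case=> *; subst=> //; move: h h'; lia.
rewrite -(card_in_imset f_inj); apply: eq_card => -[[u c] [v d]].
rewrite inE /=; apply/idP/imsetP => [h|[[d' [u' v']]]].
  have ed : d = c by move: h; rewrite /is_inversion /= => /and3P[/eqP].
  move: h; rewrite ed is_inversionE => /andP[h1 h2].
  have nuv : u != v by apply: contraTneq h1 => ->; rewrite row_ltE ltnn.
  case: (ltngtP u v) => [lt|lt|/val_inj e]; last by rewrite e eqxx in nuv.
    exists (c, (u, v)); last by rewrite /f h1.
    rewrite !inE /= lt h1 /= andbT.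
    by move: h2; rewrite row_lt_antisym // => /negPf ->.
  have h3 : row_lt t v u c = false.
    by rewrite row_lt_antisym // h1.
  exists (c, (v, u)); last by rewrite /f h3.
  by rewrite !inE /= lt h3 h2.
rewrite !inE /= => /andP[+ lt]; rewrite lt /=.
have nuv : u' != v' by rewrite -(inj_eq val_inj) neq_ltn lt.
case: ifP => h; rewrite eq_sym => h' [-> -> -> ->]; rewrite is_inversionE.
  by rewrite h row_lt_antisym //; move: h'; case: row_lt.
by rewrite row_lt_antisym // h; move: h'; case: row_lt.
Qed.

(** * Column orders of a tableau with one defect *)

Definition rank_sorted (m n : nat) (t : filling m n) (k r0 : nat) : Prop :=
  forall (u v : 'I_m) c, c <= n ->
    row_lt t u v c = (row_rank m n k r0 c u < row_rank m n k r0 c v).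

Lemma rank_sortedE (m n : nat) (t : filling m n) (k r0 : nat) (u v : 'I_m)
    (c : 'I_n) : rank_sorted t k r0 ->
  (t (u, c) < t (v, c)) = (row_rank m n k r0 c u < row_rank m n k r0 c v).
Proof. by move=> srt; rewrite -row_ltE srt // ltnW. Qed.

Lemma in_defects (m n : nat) (t : filling m n) (k r0 : nat) (x : _ * (_ * _)) :
  r0.+1 < m -> rank_sorted t k r0 ->
  (x \in defects t) =
  [&& x.1.+1 == k, x.2.1 == r0 :> nat & x.2.2 == r0.+1 :> nat].
Proof.
case: x => c [u v] hr0 srt; rewrite inE /=.
case: (ltnP u v) => huv /=; last by lia.
by rewrite (srt _ _ _ (ltnW (ltn_ord c))) srt // row_rank_stable.
Qed.

Lemma card_defects (m n : nat) (t : filling m n) (k r0 : nat) :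
  k <= n -> r0.+1 < m -> rank_sorted t k r0 -> #|defects t| = (0 < k).
Proof.
move=> hk hr0 srt; case: k hk srt => [|k] hk srt.
  by apply: eq_card0 => x; rewrite (in_defects _ hr0 srt).
rewrite -[RHS](cards1 (Ordinal hk, (Ordinal (ltnW hr0), Ordinal hr0))).
apply: eq_card => -[c [u v]].
by rewrite (in_defects _ hr0 srt) !inE /= eqSS !xpair_eqE -!(inj_eq val_inj).
Qed.

Lemma defect_rank_sorted (m n : nat) (t : filling m n) (c0 : 'I_n)
    (r s : 'I_m) :
  injective t -> defects t = [set (c0, (r, s))] ->
  r.+1 = s /\ rank_sorted t c0.+1 r.
Proof.
move=> inj def.
(* Induction backwards from the virtual column [n]: each step reverses every pair, except the pair
   [(r, s)] at column [c0]. *)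
have ordE (u v : 'I_m) c : u < v -> c <= n ->
    row_lt t u v c = ~~ odd (n - c) (+) [&& c <= c0, u == r & v == s].
  move=> huv; elim: {c}(n - c) {-2}c (erefl (n - c)) => [|d IHd] c ed hc.
    have -> : c = n by lia.
    by rewrite row_lt_last huv subnn leqNgt ltn_ord.
  have hcn : c < n by lia.
  have := IHd c.+1; rewrite subnS ed => /(_ erefl hcn) IHc.
  have : ((Ordinal hcn, (u, v)) \in defects t) = [&& c == c0, u == r & v == s].
    by rewrite def inE !xpair_eqE -(inj_eq val_inj).
  rewrite inE /= huv IHc /=.
  case: row_lt; case: (u == r); case: (v == s); case: odd => /=; lia.
have hrs : r < s.
  have : (c0, (r, s)) \in defects t by rewrite def inE.
  by rewrite inE => /andP[].
have srs : r.+1 = s.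
  (* For a row [q] strictly between [r] and [s], column [c0] would order [(r, q)] and [(q, s)] one
     way and [(r, s)] the other, a cycle. *)
  apply/eqP; rewrite eqn_leq hrs leqNgt; apply/negP => hq.
  have hqm : r.+1 < m by apply: leq_trans (ltn_ord s); exact: ltnW.
  pose q := Ordinal hqm.
  have := ordE r s c0 hrs (ltnW (ltn_ord c0)).
  have := ordE q s c0 hq (ltnW (ltn_ord c0)).
  have := ordE r q c0 (ltnSn r) (ltnW (ltn_ord c0)).
  have -> : (q == r) = false by apply/negP => /eqP/(congr1 val) /=; lia.
  have -> : (q == s) = false by apply/negP => /eqP/(congr1 val) /=; lia.
  by rewrite !row_ltE !eqxx leqnn; case: odd => /=; lia.
split=> // u v c hc.
have main (u' v' : 'I_m) : u' < v' -> row_lt t u' v' c =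
    (row_rank m n c0.+1 r c u' < row_rank m n c0.+1 r c v').
  move=> huv; rewrite ordE // row_rank_ltn ?srs //.
case: (ltngtP u v) => [/main //|huv|/val_inj ->].
  have nuv : v != u by rewrite -(inj_eq val_inj) neq_ltn huv.
  rewrite row_lt_antisym // main // -leqNgt leq_eqVlt; case: eqP => // e.
  have : u = v :> nat by apply: row_rank_inj e; rewrite ?srs.
  by move/val_inj => e'; rewrite e' eqxx in nuv.
by rewrite ltnn /row_lt; case: insubP => *; rewrite ltnn.
Qed.

(** * Fillings with a prescribed defect *)

Definition defect_filling (m n k r0 : nat) (b : bool) : filling m n :=
  filling_of m n (fun r c =>
    let v := block_value m n k r0 r c in if b then swapS (k * m).-1 v else v).

(** The exchange marked by [b] takes place at the border of two actual columns, hence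
    [0 < k < n]. *)
Definition admissible (m n k r0 : nat) (b : bool) : Prop :=
  [/\ r0.+1 < m, k <= n & b -> 0 < k < n /\ r0 = top_row m n k].

Lemma defect_fillingE (m n k r0 : nat) (b : bool) (x : cell m n) :
  admissible m n k r0 b ->
  defect_filling m n k r0 b x =
  (let v := block_value m n k r0 x.1 x.2 in
   if b then swapS (k * m).-1 v else v) :> nat.
Proof.
case: x => u c [hr0 hk hb]; rewrite filling_ofE //=.
have hv : block_value m n k r0 u c < m * n by apply: block_value_lt.
case: b hb => // /(_ isT) [/andP[k0 kn] _]; apply: swapS_lt => //.
by rewrite prednK ?muln_gt0 ?k0 1?mulnC ?ltn_pmul2l //; lia.
Qed.

Lemma defect_filling_inj (m n k r0 : nat) (b : bool) :
  admissible m n k r0 b -> injective (defect_filling m n k r0 b).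
Proof.
move=> adm x y /(congr1 val) /=; rewrite !defect_fillingE //=.
case: adm => hr0 _ _; case: b => [/swapS_inj|] /block_value_cell_inj -> //.
Qed.

Lemma defect_filling_row_standard (m n k r0 : nat) (b : bool) :
  admissible m n k r0 b -> row_standard (defect_filling m n k r0 b).
Proof.
move=> adm; apply/row_standardP => r c1 c2 lt12; rewrite !defect_fillingE //=.
case: adm => hr0 _ hb.
have ltb : block_value m n k r0 r c1 < block_value m n k r0 r c2.
  by rewrite block_value_ltn // lt12.
case: b hb => // /(_ isT) [k0n er0]; rewrite swapS_ltn ltb /=.
(* The exchange spoils a row only if both border values lie in it, which [row_rank_top] excludes. *)
apply/orP; right; apply/negP => /andP[/eqP e1 /eqP].
have /andP[k0 _] := k0n.
rewrite prednK ?muln_gt0 ?k0; last by lia.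
move=> e2; have [ec1 e1'] := block_value_max k0 hr0 (ltn_ord r) e1.
have [ec2 e2'] := block_value_min hr0 (ltn_ord r) e2.
move: e1' e2'; rewrite ec1 ec2 er0; apply: row_rank_top => //; lia.
Qed.

Lemma defect_filling_rank_sorted (m n k r0 : nat) (b : bool) :
  admissible m n k r0 b -> rank_sorted (defect_filling m n k r0 b) k r0.
Proof.
move=> adm u v c; rewrite leq_eqVlt => /orP[/eqP->|hc].
  case: adm => hr0 hk _.
  by rewrite row_lt_last /row_rank subnn /= (ltnNge n) hk.
have -> : c = Ordinal hc by [].
rewrite row_ltE !defect_fillingE //=; case: adm => hr0 _ hb.
have bE : (block_value m n k r0 u c < block_value m n k r0 v c) =
    (row_rank m n k r0 c u < row_rank m n k r0 c v).
  by rewrite /block_value ltn_add2l.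
case: b hb => // /(_ isT) [/andP[k0 kn] _]; rewrite swapS_ltn bE.
rewrite prednK ?muln_gt0 ?k0; last by lia.
(* The exchanged values lie in different columns, so no order within a column changes. *)
have sep (w w' : 'I_m) : (block_value m n k r0 w c == (k * m).-1) &&
    (block_value m n k r0 w' c == k * m) = false.
  apply/negP => /andP[/eqP/(block_value_max k0 hr0 (ltn_ord w))[e1 _]].
  by move/eqP/(block_value_min hr0 (ltn_ord w'))=> [e2 _]; lia.
by rewrite sep andbC sep andbT.
Qed.

(** * Recovering a tableau from its column orders *)

(** The chain is [t (u, c) <= t (w, c) < t (w, d) <= t (v, d)]. *)
Lemma lt_through_row (m n : nat) (t : filling m n) (k r0 : nat)
    (u v w : 'I_m) (c d : 'I_n) :
  row_standard t -> rank_sorted t k r0 -> c < d ->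
  row_rank m n k r0 c u <= row_rank m n k r0 c w ->
  row_rank m n k r0 d w <= row_rank m n k r0 d v ->
  t (u, c) < t (v, d).
Proof.
move=> /row_standardP std srt lcd; have := std w _ _ lcd.
rewrite !(leqNgt (row_rank _ _ _ _ _ _)) -!(rank_sortedE _ _ _ srt).
by lia.
Qed.

Lemma block_value_lt_entry (m n : nat) (t : filling m n) (k r0 : nat)
    (x y : cell m n) :
  0 < k <= n -> r0.+1 < m -> row_standard t -> rank_sorted t k r0 ->
  block_value m n k r0 x.1 x.2 < block_value m n k r0 y.1 y.2 ->
  t x < t y \/
  [/\ k < n, r0 = top_row m n k,
      block_value m n k r0 x.1 x.2 = (k * m).-1 &
      block_value m n k r0 y.1 y.2 = k * m].
Proof.
case: x y => [u c] [v d] /= /andP[k0 kn] hr0 std srt.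
have stdP := row_standardP _ std.
rewrite block_value_ltn //; case/orP=> [lcd|/andP[/eqP/val_inj <-]]; last first.
  by rewrite -(rank_sortedE _ _ _ srt); left.
(* Away from the defect, adjacent columns have opposite orders, so [u'] or [v'] itself is a suitable
   common row. *)
have next (u' v' : 'I_m) (c' d' : 'I_n) : d' = c'.+1 :> nat -> c'.+1 != k ->
    t (u', c') < t (v', d').
  move=> ed nk; have lt : c' < d' by rewrite ed.
  have := row_rank_next (ltn_ord c') nk hr0 (ltn_ord u').
  have := row_rank_next (ltn_ord c') nk hr0 (ltn_ord v').
  rewrite -ed => eu ev.
  case: (leqP (row_rank m n k r0 d' u') (row_rank m n k r0 d' v')) => h.
    by apply: (lt_through_row (w := u') std srt).
  by apply: (lt_through_row (w := v') std srt) => //; lia.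
have hc1 : c.+1 < n by apply: leq_ltn_trans (ltn_ord d).
have le_row (w : 'I_m) (a b : 'I_n) : a <= b -> t (w, a) <= t (w, b).
  by rewrite leq_eqVlt => /orP[/eqP/val_inj-> //|/(stdP w)/ltnW].
have [ek|nk] := eqVneq c.+1 k; last first.
  left; apply: leq_trans (le_row v (Ordinal hc1) d lcd).
  exact: next.
case: (ltngtP c.+1 d) => [lt|lt|ed]; [|by lia|].
  have hc2 : c.+2 < n by apply: leq_ltn_trans (ltn_ord d).
  (* The defect is bypassed: row [u] leads to column [k], and the step from [k] to [k.+1] is a full
     reversal. *)
  left; apply: leq_trans (le_row v (Ordinal hc2) d lt).
  apply: ltn_trans (stdP u c (Ordinal hc1) (ltnSn c)) _.
  by apply: next => //=; rewrite -ek; lia.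
have ekd : k = d by rewrite -ek.
have ekc : k.-1 = c by rewrite -ek.
have k0n : 0 < k < n by rewrite k0 ekd ltn_ord.
case: (row_rank_bridge k0n hr0 (ltn_ord u) (ltn_ord v)) => [[w hw]|[e1 e2 e3]].
  rewrite ekc => -[h1]; rewrite {2 4}ekd => h2.
  by left; apply: (lt_through_row (w := Ordinal hw) std srt).
right; split=> //; first by rewrite ekd.
  rewrite /block_value -ekc e2 -{2}(prednK k0) mulSn; lia.
by rewrite /block_value -ekd e3 addn0.
Qed.

Lemma rank_sorted_filling (m n : nat) (t : filling m n) (k r0 : nat) :
  0 < k <= n -> r0.+1 < m ->
  injective t -> row_standard t -> rank_sorted t k r0 ->
  exists2 b, admissible m n k r0 b & t = defect_filling m n k r0 b.
Proof.
move=> k0n hr0 inj std srt; have /andP[k0 kn] := k0n.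
have km0 : 0 < k * m by rewrite muln_gt0 k0; lia.
(* [P] says that the border values occur in exchanged order, which decides [b]. *)
pose P (xy : cell m n * cell m n) :=
  [&& block_value m n k r0 xy.1.1 xy.1.2 == (k * m).-1,
      block_value m n k r0 xy.2.1 xy.2.2 == k * m, k < n,
      r0 == top_row m n k & t xy.2 < t xy.1].
have [/existsP[[x y] /and5P[/= /eqP ex /eqP ey lkn /eqP er0 lt]]|none] :=
  boolP [exists xy, P xy].
  have adm : admissible m n k r0 true by split=> // _; rewrite k0.
  exists true => //; apply: tableau_eq => // [|x' y'].
    exact: defect_filling_inj.
  rewrite !defect_fillingE //= swapS_ltn prednK //.
  case/orP => [/andP[/eqP e1 /eqP e2]|/andP[lt' ne]].
    have -> : x' = y by apply: (@block_value_cell_inj m n k r0); rewrite //= e1.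
    by have -> : y' = x by apply: (@block_value_cell_inj m n k r0);
      rewrite //= e2.
  case: (block_value_lt_entry k0n hr0 std srt lt') => // -[_ _ e1 e2].
  by rewrite e1 e2 !eqxx in ne.
have adm : admissible m n k r0 false by split.
exists false => //; apply: tableau_eq => // [|x y].
  exact: defect_filling_inj.
rewrite !defect_fillingE //= => lt.
case: (block_value_lt_entry k0n hr0 std srt lt) => // -[lkn er0 e1 e2].
case: (ltngtP (t x) (t y)) => // [lt'|/val_inj/inj e].
  case/negP: none; apply/existsP; exists (x, y).
  by rewrite /P /= e1 e2 lkn -er0 !eqxx lt'.
by rewrite e ltnn in lt.
Qed.

(** The defect, present since [0 < k], determines [k] and [r0]; the cell holding [(k * m).-1] before
    the exchange then tells [b]. *)
Lemma defect_filling_uniq (m n k r0 k' r0' : nat) (b b' : bool) :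
  0 < k -> admissible m n k r0 b -> admissible m n k' r0' b' ->
  defect_filling m n k r0 b = defect_filling m n k' r0' b' ->
  [/\ k = k', r0 = r0' & b = b'].
Proof.
move=> k0 adm adm' e; have [hr0 hk hb] := adm; have [hr0' hk' hb'] := adm'.
have srt := defect_filling_rank_sorted adm.
have srt' := defect_filling_rank_sorted adm'.
have hk1 : k.-1 < n by rewrite prednK.
pose x := (Ordinal hk1, (Ordinal (ltnW hr0), Ordinal hr0)).
have : x \in defects (defect_filling m n k r0 b).
  by rewrite (in_defects _ hr0 srt) /= prednK // !eqxx.
rewrite e (in_defects _ hr0' srt') /= prednK // => /and3P[/eqP ek /eqP er _].
subst k' r0'; split=> //.
have differ : admissible m n k r0 true ->
    defect_filling m n k r0 true <> defect_filling m n k r0 false.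
  move=> admT; have admF : admissible m n k r0 false by split.
  have [_ _ /(_ isT) [/andP[_ kn] _]] := admT.
  have km0 : 0 < k * m by rewrite muln_gt0 k0; lia.
  have hK : (k * m).-1 < m * n.
    by rewrite prednK // mulnC leq_mul2l hk orbT.
  have /is_tableauP/andP[_ /forallP/(_ (Ordinal hK))/existsP[z /eqP ez]] :=
    defect_filling_inj admF.
  move=> /ffunP/(_ z)/(congr1 val) /=.
  move/(congr1 val): ez => /=; rewrite !defect_fillingE //= => ->.
  by rewrite /swapS eqxx; lia.
by case: b b' adm adm' e {hb hb' srt srt' x} => -[] // a a' e';
  [case: (differ a) | case: (differ a')].
Qed.

(** * Counting *)

Lemma defect_filling_inversions (m n k r0 : nat) (b : bool) :
  admissible m n k r0 b ->
  inversions (defect_filling m n k r0 b) + (0 < k) = n * 'C(m, 2).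
Proof.
move=> adm; have [hr0 hk _] := adm.
rewrite -(inversions_defects (defect_filling_inj adm)).
by rewrite (card_defects hk hr0 (defect_filling_rank_sorted adm)).
Qed.

Lemma defect_filling_tableau (m n k r0 : nat) (b : bool) :
  admissible m n k r0 b ->
  defect_filling m n k r0 b \in row_standard_tableaux m n.
Proof.
move=> adm; rewrite inE defect_filling_row_standard // andbT.
exact/is_tableauP/defect_filling_inj.
Qed.

Lemma max_inversionsE (m n : nat) : 1 < m -> max_inversions m n = n * 'C(m, 2).
Proof.
(* With [k = 0] there is no defect, so this filling attains the bound. *)
move=> hm; have adm : admissible m n 0 0 false by split.
apply/eqP; rewrite eqn_leq; apply/andP; split.
  apply/bigmax_leqP => t; rewrite inE => /andP[/is_tableauP inj _].
  by rewrite -(inversions_defects inj) leq_addr.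
rewrite -(defect_filling_inversions adm) addn0.
exact/(leq_bigmax_cond (F := @inversions m n))/defect_filling_tableau.
Qed.

(* [inl (c, r)]: only the pair of rows r, r + 1 of column c is not inverted, and
   columns occupy consecutive intervals of values; [inr c]: moreover these rows
   are the top ones and the values at the border of columns c, c + 1 are
   exchanged. *)
Definition defect_label (m n : nat) : finType :=
  ('I_n * 'I_m.-1 + 'I_n.-1)%type.

Definition label_filling (m n : nat) (l : defect_label m n) : filling m n :=
  match l with
  | inl (c, r) => defect_filling m n c.+1 r false
  | inr c => defect_filling m n c.+1 (top_row m n c.+1) true
  end.

Lemma admissible_inl (m n : nat) (c : 'I_n) (r : 'I_m.-1) :
  admissible m n c.+1 r false.
Proof. by split=> //; have := ltn_ord r; lia. Qed.

Lemma admissible_inr (m n : nat) (c : 'I_n.-1) : 1 < m ->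
  admissible m n c.+1 (top_row m n c.+1) true.
Proof.
by move=> hm; have := ltn_ord c; split; rewrite ?top_row_lt //; lia.
Qed.

Lemma label_filling_inj (m n : nat) :
  1 < m -> injective (@label_filling m n).
Proof.
move=> hm [[c r]|c] [[d s]|d] /= e.
- have [/succn_inj/val_inj-> /val_inj->] := defect_filling_uniq (ltn0Sn c)
    (admissible_inl c r) (admissible_inl d s) e.
  by [].
- by case: (defect_filling_uniq (ltn0Sn c)
    (admissible_inl c r) (admissible_inr d hm) e).
- by case: (defect_filling_uniq (ltn0Sn c)
    (admissible_inr c hm) (admissible_inl d s) e).
- have [/succn_inj/val_inj->] := defect_filling_uniq (ltn0Sn c)
    (admissible_inr c hm) (admissible_inr d hm) e.
  by [].
Qed.

Lemma S_submax (m n : nat) : 1 <= n -> 1 < m ->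
  S_ (max_inversions m n - 1) m n =
  [set label_filling l | l : defect_label m n].
Proof.
move=> hn hm; have M0 : 0 < n * 'C(m, 2) by rewrite muln_gt0 hn bin_gt0.
rewrite max_inversionsE //; apply/setP => t; apply/idP/imsetP.
  rewrite !inE => /andP[/andP[/is_tableauP inj std] /eqP einv].
  have := inversions_defects inj; rewrite einv => cardD.
  have /cards1P[[c [r s]] eD] : #|defects t| == 1 by lia.
  have [ers srt] := defect_rank_sorted inj eD.
  have hr : r.+1 < m by rewrite ers.
  (* The defect column [c] is the last one with swapped rows, so [k] is [c.+1]. *)
  have hc : 0 < c.+1 <= n by exact: ltn_ord.
  have [b adm ->] := rank_sorted_filling hc hr inj std srt.
  case: b adm => adm.
    have [_ _ /(_ isT) [hcn ->]] := adm.
    have hc' : c < n.-1 by lia.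
    by exists (inr (Ordinal hc')).
  have hr' : r < m.-1 by lia.
  by exists (inl (c, Ordinal hr')).
case=> l _ ->.
have [k [r0 [b [k0 adm ->]]]] : exists k r0 b, [/\ 0 < k,
    admissible m n k r0 b & label_filling l = defect_filling m n k r0 b].
  case: l => [[c r]|c].
    by exists c.+1, r, false; split=> //; apply: admissible_inl.
  by exists c.+1, (top_row m n c.+1), true; split=> //; apply: admissible_inr.
rewrite inE defect_filling_tableau //=.
by have := defect_filling_inversions adm; rewrite k0; lia.
Qed.

Theorem theorem4p1 (m n : nat) (hn : 1 <= n) (hm : 2 <= m) :
  [/\ max_inversions m n = n * triangular (m - 1),
      n * triangular (m - 1) = n * 'C(m, 2) &
      #|S_ (max_inversions m n - 1) m n| = m * n - 1].
Proof.
have triE : triangular (m - 1) = 'C(m, 2).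
  by rewrite /triangular subn1 prednK 1?ltnW // divn2 bin2 mulnC.
(* The formulas settle the first two claims; the maximum is then folded back so that [S_submax]
   applies. *)
split; rewrite ?triE ?max_inversionsE // -max_inversionsE // S_submax //.
rewrite card_imset; last exact: label_filling_inj.
rewrite card_sum card_prod !card_ord.
case: m n hn hm {triE} => [|m] [|n] //= _ _; lia.
Qed.
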